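(* Let $A,B,C\in\mathbb{C}^{N\times N}$ be commutative (pairwise commuting) matrices such that $B+sI$ and $C+sI$ are invertible for every integer $s\ge 0$. Then ${}_1F_2(A;B,C;z)=\sum_{s=0}^{\infty}z^sU_s$, with $U_s=\frac{1}{s!}(A)_s[(B)_s]^{-1}[(C)_s]^{-1}$, is an entire function of $z$ of order $\frac12$.
   Context: $I$ is the $N\times N$ identity matrix. For $M\in\mathbb{C}^{N\times N}$, $(M)_0=I$ and $(M)_s=M(M+I)\cdots(M+(s-1)I)$ for $s\ge1$. $\|\cdot\|$ is the operator 2-norm. The order of an entire function $f(z)=\sum_{s\ge0}z^sU_s$ with matrix coefficients is $$\rho(f)=\limsup_{s\to\infty}\frac{s\ln s}{\ln\left(1/\|U_s\|\right)}.$$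
   Formalization: The order 1/2 is asserted only when (A)_s ≠ 0 for every s; if some (A)_s = 0 (e.g. A = 0) the series is a polynomial and the order formula gives 0, so the claim as stated fails there. Entireness is proved under the original hypotheses. *)

(* Defs.v *)
From mathcomp Require Import all_boot all_order all_algebra.
From mathcomp Require Import complex.
From mathcomp Require Import all_classical all_reals all_analysis.

Set Implicit Arguments.
Unset Strict Implicit.
Unset Printing Implicit Defensive.

Import Order.TTheory GRing.Theory Num.Theory.
Import numFieldNormedType.Exports.

Local Open Scope classical_set_scope.
Local Open Scope ring_scope.
Local Open Scope complex_scope.

Section MatrixPowerSeries.
Variables (K : numFieldType) (N : nat).
Implicit Types (U : nat -> 'M[K]_N).

Definition mxpseries U (z : K) : nat -> 'M[K]_N :=
  series (fun s => z ^+ s *: U s).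

Definition mxpseries_sum U (z : K^o) : 'M[K]_N := limn (mxpseries U z).

(* For [K := R[i]], the complex plane: the series converges everywhere and its
   sum is everywhere complex differentiable, the increments in [derivable]
   ranging over [K].  The topology on matrices is that of the entrywise sup
   norm, i.e. the only norm topology in finite dimension. *)
Definition entire_mxpseries U : Prop :=
  (forall z : K, cvgn (mxpseries U z)) /\
  (forall z : K^o, derivable (mxpseries_sum U) z 1).

End MatrixPowerSeries.

Section Hypergeometric.
Variables (R : realType) (N : nat).
Implicit Types (M A B C : 'M[R[i]]_N) (U : nat -> 'M[R[i]]_N).

(* [normc z : R] is the real-valued modulus; the norm of the numDomainType
   [R[i]] takes its values in [R[i]]. *)
Definition l2norm (v : 'cV[R[i]]_N) : R :=
  Num.sqrt (\sum_(i < N) ComplexField.Normc.normc (v i 0) ^+ 2).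

Definition opnorm2 M : R :=
  sup [set l2norm (M *m v) | v in [set v : 'cV[R[i]]_N | l2norm v <= 1]].

Definition mxpoch M (s : nat) : 'M[R[i]]_N := \prod_(j < s) (M + j%:R%:M).

(* Since [0^-1 = 0] and [ln 0 = 0], a term with [U s = 0] is 0, in accordance
   with the convention [s ln s / ln (1 / 0) = s ln s / +oo = 0]. *)
Definition mxpseries_order U : \bar R :=
  limn_esup (fun s : nat => (s%:R * ln s%:R / ln (1 / opnorm2 (U s)))%:E).

Definition hyp1F2_coef A B C (s : nat) : 'M[R[i]]_N :=
  (s`!%:R)^-1 *: (mxpoch A s *m invmx (mxpoch B s) *m invmx (mxpoch C s)).

End Hypergeometric.

(* Main.v *)
Require Import Defs.
From mathcomp Require Import all_boot all_order all_algebra.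
From mathcomp Require Import complex.
From mathcomp Require Import all_classical all_reals all_analysis.
From mathcomp Require Import ring lra.

(** Write [a], [b], [c] and [u_s] for the sizes of [A], [B], [C] and [U_s] in a
    submultiplicative norm.  Since the matrices commute, the coefficients obey
    [[
      (s + 1) (B + s) (C + s) U_(s+1) = (A + s) U_s ,
    ]]
    and [s - |M| <= |M + s| <= s + |M|] in the sense that multiplication by
    [M + s] stretches every matrix by a factor in that interval.  Hence
    [u_(s+1) / u_s] lies between [1/8] and [8] times [(s + 1)^-2] once [s] is
    large.  Iterating, [(s!)^2 u_s] lies between two geometric progressions
    ([mxnorm1_hyp1F2_coef_upper], [mxnorm1_hyp1F2_coef_lower]); the lower one
    needs [U_s <> 0], which is where the non-vanishing of [(A)_s] enters.

    The upper bound makes [sum u_s r^s] converge for every [r].  This is enough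
    for the sum to be entire ([entire_mxpseries_summable]): partial sums of the
    real and imaginary parts of each entry converge absolutely, and the Taylor
    remainder of order one of [z^s] is at most [|h|^2 (2 r)^s] on the disk of
    radius [r >= 1], so the remainder of the sum is [O(|h|^2)].

    With both bounds, [ln (1 / u_s) = 2 ln s! + O(s) = 2 s ln s + O(s)], so the
    quotient defining the order converges to [1/2] ([cvg_order_half]).

    The norm used is the entrywise one, [mxnorm1].  It is equivalent to the
    operator 2-norm, and a bounded factor in [u_s] is absorbed by the constants
    of the two geometric bounds. *)

Set Implicit Arguments.
Unset Strict Implicit.
Unset Printing Implicit Defensive.

Import Order.TTheory GRing.Theory Num.Theory.
Import numFieldNormedType.Exports.

Local Open Scope ring_scope.
Local Open Scope complex_scope.

Import ComplexField.Normc.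

(** * The complex modulus *)

Section Modulus.
Variable R : realType.
Implicit Types x y : R[i].

Lemma normc_ge0 x : 0 <= normc x.
Proof. by case: x => a b; exact: sqrtr_ge0. Qed.

Lemma normcX x n : normc (x ^+ n) = normc x ^+ n.
Proof.
elim: n => [|n IHn]; first by rewrite !expr0 normc1.
by rewrite !exprS normcM IHn.
Qed.

Lemma normc_nat n : normc (n%:R : R[i]) = n%:R.
Proof. by rewrite normcMn normc1. Qed.

Lemma normr_Re x : `|complex.Re x| <= normc x.
Proof.
by case: x => a b /=; rewrite -sqrtr_sqr ler_wsqrtr // lerDl sqr_ge0.
Qed.

Lemma normr_Im x : `|complex.Im x| <= normc x.
Proof.
by case: x => a b /=; rewrite -sqrtr_sqr ler_wsqrtr // lerDr sqr_ge0.
Qed.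

Lemma normc_le_ReIm x : normc x <= `|complex.Re x| + `|complex.Im x|.
Proof.
case: x => a b /=.
rewrite -[leRHS]ger0_norm ?addr_ge0 // -sqrtr_sqr ler_wsqrtr //.
by rewrite sqrrD !real_normK ?num_real // lerD2r lerDl mulrn_wge0 //.
Qed.

Lemma normc_sum (I : Type) (r : seq I) (P : pred I) (F : I -> R[i]) :
  normc (\sum_(i <- r | P i) F i) <= \sum_(i <- r | P i) normc (F i).
Proof.
elim/big_ind2 : _ => [|x1 x2 y1 y2 h1 h2|//].
  by rewrite normc0.
by rewrite (le_trans (le_normcD _ _)) // lerD.
Qed.

End Modulus.

(** * The entrywise sum norm on complex matrices *)

Section EntrywiseNorm.
Variable R : realType.

Definition mxnorm1 m n (M : 'M[R[i]]_(m, n)) : R :=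
  \sum_i \sum_j normc (M i j).

Lemma mxnorm1_ge0 m n (M : 'M[R[i]]_(m, n)) : 0 <= mxnorm1 M.
Proof.
by rewrite sumr_ge0 // => i _; rewrite sumr_ge0 // => *; exact: normc_ge0.
Qed.

Lemma normc_le_mxnorm1 m n (M : 'M[R[i]]_(m, n)) i j :
  normc (M i j) <= mxnorm1 M.
Proof.
rewrite /mxnorm1 (bigD1 i) //= (bigD1 j) //= -addrA lerDl addr_ge0 //.
  by rewrite sumr_ge0 // => *; exact: normc_ge0.
by rewrite sumr_ge0 // => *; rewrite sumr_ge0 // => *; exact: normc_ge0.
Qed.

Lemma mxnorm1_le m n (M : 'M[R[i]]_(m, n)) (e : R) :
  (forall i j, normc (M i j) <= e) -> mxnorm1 M <= (m * n)%:R * e.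
Proof.
move=> Me; rewrite (_ : _ * e = \sum_(i < m) \sum_(j < n) e); last first.
  by rewrite !sumr_const !card_ord -mulrnA mulr_natl mulnC.
by apply: ler_sum => i _; apply: ler_sum => j _.
Qed.

Lemma mxnorm1_0 m n : mxnorm1 (0 : 'M[R[i]]_(m, n)) = 0.
Proof.
by rewrite /mxnorm1 big1 // => i _; rewrite big1 // => j _; rewrite mxE normc0.
Qed.

Lemma mxnorm1_gt0 m n (M : 'M[R[i]]_(m, n)) : M != 0 -> 0 < mxnorm1 M.
Proof.
move=> M0; rewrite lt_neqAle mxnorm1_ge0 andbT; apply: contra M0 => /eqP M0.
apply/eqP/matrixP => i j; rewrite mxE; apply: eq0_normc.
by apply/eqP; rewrite eq_le normc_ge0 andbT M0 normc_le_mxnorm1.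
Qed.

Lemma mxnorm1D m n (M M' : 'M[R[i]]_(m, n)) :
  mxnorm1 (M + M') <= mxnorm1 M + mxnorm1 M'.
Proof.
rewrite /mxnorm1 -big_split; apply: ler_sum => i _.
by rewrite -big_split; apply: ler_sum => j _; rewrite mxE le_normcD.
Qed.

Lemma mxnorm1Z m n a (M : 'M[R[i]]_(m, n)) :
  mxnorm1 (a *: M) = normc a * mxnorm1 M.
Proof.
rewrite /mxnorm1 mulr_sumr; apply: eq_bigr => i _.
by rewrite mulr_sumr; apply: eq_bigr => j _; rewrite mxE normcM.
Qed.

Lemma mxnorm1N m n (M : 'M[R[i]]_(m, n)) : mxnorm1 (- M) = mxnorm1 M.
Proof. by rewrite -scaleN1r mxnorm1Z normcN normc1 mul1r. Qed.

Lemma mxnorm1B_ge m n (M M' : 'M[R[i]]_(m, n)) :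
  mxnorm1 M - mxnorm1 M' <= mxnorm1 (M + M').
Proof. by rewrite lerBlDr -(mxnorm1N M') -{1}(addrK M' M) mxnorm1D. Qed.

Lemma mxnorm1_sum m n (I : Type) (r : seq I) (P : pred I)
    (F : I -> 'M[R[i]]_(m, n)) :
  mxnorm1 (\sum_(i <- r | P i) F i) <= \sum_(i <- r | P i) mxnorm1 (F i).
Proof.
elim/big_ind2 : _ => [|X1 x2 Y1 y2 h1 h2|//].
  by rewrite mxnorm1_0.
by rewrite (le_trans (mxnorm1D _ _)) // lerD.
Qed.

(** Kept apart from [mxnorm1M] because the comparison with the operator norm
    uses that the entries of [Y] are at most 1, which is sharper than a bound on
    [mxnorm1 Y]. *)
Lemma mxnorm1M_entry m n p (X : 'M[R[i]]_(m, n)) (Y : 'M[R[i]]_(n, p)) :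
  mxnorm1 (X *m Y) <= \sum_i \sum_j \sum_k normc (X i k) * normc (Y k j).
Proof.
apply: ler_sum => i _; apply: ler_sum => j _; rewrite mxE.
rewrite (le_trans (normc_sum _ _ _)) //.
by apply: ler_sum => k _; rewrite normcM.
Qed.

Lemma mxnorm1M m n p (X : 'M[R[i]]_(m, n)) (Y : 'M[R[i]]_(n, p)) :
  mxnorm1 (X *m Y) <= mxnorm1 X * mxnorm1 Y.
Proof.
apply: (le_trans (mxnorm1M_entry _ _)).
rewrite {1}/mxnorm1 mulr_suml; apply: ler_sum => i _.
rewrite exchange_big mulr_suml; apply: ler_sum => k _.
rewrite -mulr_sumr ler_wpM2l ?normc_ge0 //.
rewrite /mxnorm1 (bigD1 k) //= lerDl sumr_ge0 // => *.
by rewrite sumr_ge0 // => *; exact: normc_ge0.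
Qed.

(** This and the next lemma are the only estimates on [A + s] that the growth of
    the hypergeometric coefficients requires.  The lower one replaces a bound on
    the inverse of [A + s]: it already holds by the triangle inequality. *)
Lemma mxnorm1_shift_le n (A X : 'M[R[i]]_n) s :
  mxnorm1 ((A + s%:R%:M) *m X) <= (s%:R + mxnorm1 A) * mxnorm1 X.
Proof.
rewrite mulmxDl mul_scalar_mx addrC mulrDl (le_trans (mxnorm1D _ _)) //.
by rewrite mxnorm1Z normc_nat lerD2l mxnorm1M.
Qed.

Lemma mxnorm1_shift_ge n (A X : 'M[R[i]]_n) s :
  (s%:R - mxnorm1 A) * mxnorm1 X <= mxnorm1 ((A + s%:R%:M) *m X).
Proof.
rewrite mulmxDl mul_scalar_mx mulrBl [in leRHS]addrC.
apply: le_trans (mxnorm1B_ge _ _).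
by rewrite mxnorm1Z normc_nat lerD2l lerN2 mxnorm1M.
Qed.

Lemma l2norm_le_mxnorm1 n (v : 'cV[R[i]]_n) : l2norm v <= mxnorm1 v.
Proof.
rewrite /l2norm -[leRHS]ger0_norm ?mxnorm1_ge0 // -sqrtr_sqr ler_wsqrtr //.
rewrite (_ : mxnorm1 v = \sum_i normc (v i 0)); last first.
  by apply: eq_bigr => i _; rewrite big_ord1.
rewrite expr2 mulr_suml; apply: ler_sum => i _.
rewrite expr2 ler_wpM2l ?normc_ge0 // (bigD1 i) //= lerDl sumr_ge0 // => *.
exact: normc_ge0.
Qed.

Lemma normc_le_l2norm n (v : 'cV[R[i]]_n) i : normc (v i 0) <= l2norm v.
Proof.
rewrite -[leLHS]ger0_norm ?normc_ge0 // -sqrtr_sqr ler_wsqrtr //.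
by rewrite (bigD1 i) //= lerDl sumr_ge0 // => *; exact: sqr_ge0.
Qed.

Lemma l2norm_mulmx_le n (M : 'M[R[i]]_n) (v : 'cV[R[i]]_n) :
  l2norm v <= 1 -> l2norm (M *m v) <= mxnorm1 M.
Proof.
move=> v1; apply: (le_trans (l2norm_le_mxnorm1 _)).
apply: (le_trans (mxnorm1M_entry _ _)); apply: ler_sum => i _.
rewrite big_ord1; apply: ler_sum => j _.
by rewrite ler_piMr ?normc_ge0 // (le_trans (normc_le_l2norm _ _)).
Qed.

Lemma l2norm_delta n (j : 'I_n) : l2norm (delta_mx j 0 : 'cV[R[i]]_n) = 1.
Proof.
rewrite /l2norm (bigD1 j) //= mxE !eqxx normc1 expr1n big1 ?addr0 ?sqrtr1 //.
by move=> i ij; rewrite mxE (negbTE ij) normc0 expr0n.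
Qed.

Lemma opnorm2_le_mxnorm1 n (M : 'M[R[i]]_n) : opnorm2 M <= mxnorm1 M.
Proof.
apply: ge_sup => [|_ [v v1 <-]]; last exact: l2norm_mulmx_le.
exists (l2norm (M *m 0)), 0 => //=.
by rewrite /l2norm big1 ?sqrtr0 // => i _; rewrite mxE normc0 expr0n.
Qed.

(** The [j]-th column of [M] is the image of a unit vector. *)
Lemma normc_le_opnorm2 n (M : 'M[R[i]]_n) i j : normc (M i j) <= opnorm2 M.
Proof.
apply: (@le_trans _ _ (l2norm (M *m delta_mx j 0))).
  by rewrite -colE (le_trans _ (normc_le_l2norm _ i)) // mxE.
apply: ub_le_sup; last by exists (delta_mx j 0) => //=; rewrite l2norm_delta.
by exists (mxnorm1 M) => _ [v v1 <-]; exact: l2norm_mulmx_le.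
Qed.

Lemma mxnorm1_le_opnorm2 n (M : 'M[R[i]]_n) :
  mxnorm1 M <= (n * n)%:R * opnorm2 M.
Proof. by apply: mxnorm1_le => i j; exact: normc_le_opnorm2. Qed.

End EntrywiseNorm.

(** * Convergence of complex matrices *)

Section MatrixConvergence.
Local Open Scope classical_set_scope.
Variables (R : realType) (n : nat).
(* The topology of a number field is attached to its numFieldType structure and
   would not be found on the bare type [R[i]]. *)
Local Notation C := (R[i] : numFieldType).
Implicit Types (L : 'M[C]_n).

(** Radii of balls are elements of [R[i]]; a positive one is a real number. *)
Lemma gt0_complexE (e : R[i]) :
  0 < e -> e = (complex.Re e)%:C /\ 0 < complex.Re e.
Proof. by case: e => a b; rewrite ltcE /= => /andP[/eqP -> ?]. Qed.

Lemma cvg_mxnorm1P (T : Type) (F : set_system T) (FF : Filter F)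
    (f : T -> 'M[C]_n) L :
  f x @[x --> F] --> L <->
  (forall e : R, 0 < e -> \forall x \near F, mxnorm1 (L - f x) < e).
Proof.
split=> [/cvg_ballP fL e e0|fL].
  have e'0 : 0 < e / (n * n).+1%:R by rewrite divr_gt0.
  have /fL : 0 < (e / (n * n).+1%:R)%:C by rewrite ltcR.
  apply: filterS => x [_ Lfx].
  apply: (@le_lt_trans _ _ ((n * n)%:R * (e / (n * n).+1%:R))).
    apply: mxnorm1_le => i j; have := Lfx i j.
    by rewrite -ball_normE /= !mxE => /ltW; rewrite lecR.
  by rewrite mulrCA gtr_pMr // ltr_pdivrMr // mul1r ltr_nat.
apply/cvg_ballP => e /gt0_complexE[-> e0]; apply: filterS (fL _ e0) => x Lfx.
split=> [|i j]; first by rewrite ltcR.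
rewrite -ball_normE /= ltcR.
by have := normc_le_mxnorm1 (L - f x) i j; rewrite !mxE => /le_lt_trans; apply.
Qed.

Lemma mxnorm1_cvg_le (T : Type) (F : set_system T) (FF : ProperFilter F)
    (f : T -> 'M[C]_n) L (b : R) :
  f x @[x --> F] --> L -> (forall x, mxnorm1 (f x) <= b) -> mxnorm1 L <= b.
Proof.
move=> /cvg_mxnorm1P fL fb; apply/ler_addgt0Pl => e e0.
have [x Lfx] := filter_ex (fL _ e0).
by rewrite -(subrK (f x) L) (le_trans (mxnorm1D _ _)) // lerD // ltW.
Qed.

(** Completeness of the space of complex matrices, in the form needed for power
    series; it is reduced to absolute convergence in [R] of the real and
    imaginary part of each entry. *)
Lemma cvg_series_mxnorm1 (X : nat -> 'M[C]_n) (b : R ^nat) :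
  (forall s, mxnorm1 (X s) <= b s) -> cvgn (series b) -> cvgn (series X).
Proof.
move=> Xb cb.
have cvg_part (p : {additive R[i] -> R}) (i j : 'I_n) :
    (forall z, `|p z| <= normc z) -> cvgn (series (fun s => p (X s i j))).
  move=> p_le; apply: normed_cvg; apply: series_le_cvg cb => [s|s|s] /=.
  - by [].
  - by rewrite (le_trans _ (Xb s)) // mxnorm1_ge0.
  - by rewrite (le_trans (p_le _)) // (le_trans _ (Xb s)) // normc_le_mxnorm1.
have cRe i j := cvg_part (@complex.Re R) i j (@normr_Re R).
have cIm i j := cvg_part (@complex.Im R) i j (@normr_Im R).
pose lim_part (p : R[i] -> R) i j : R := limn (series (fun s => p (X s i j))).
apply/cvg_ex; exists (\matrix_(i, j)
  (lim_part (@complex.Re R) i j +i* lim_part (@complex.Im R) i j)).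
apply/cvg_mxnorm1P => e e0.
have e'0 : 0 < e / (n * n).+1%:R / 2 by rewrite !divr_gt0.
have nearRe : \forall m \near \oo, forall ij : 'I_n * 'I_n,
    `|lim_part (@complex.Re R) ij.1 ij.2
       - series (fun s => complex.Re (X s ij.1 ij.2)) m|
    < e / (n * n).+1%:R / 2.
  apply: filter_forall => -[i j]; move/cvgrPdist_lt: (cRe i j); exact.
have nearIm : \forall m \near \oo, forall ij : 'I_n * 'I_n,
    `|lim_part (@complex.Im R) ij.1 ij.2
       - series (fun s => complex.Im (X s ij.1 ij.2)) m|
    < e / (n * n).+1%:R / 2.
  apply: filter_forall => -[i j]; move/cvgrPdist_lt: (cIm i j); exact.
apply: filterS2 nearRe nearIm => m mRe mIm.
apply: (@le_lt_trans _ _ ((n * n)%:R * (e / (n * n).+1%:R))); last first.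
  by rewrite mulrCA gtr_pMr // ltr_pdivrMr // mul1r ltr_nat.
apply: mxnorm1_le => i j; rewrite (le_trans (normc_le_ReIm _)) //.
rewrite [leRHS]splitr !mxE !raddfB /= !summxE !raddf_sum.
rewrite lerD // ltW // [X in _ + X]sumrN.
  exact: (mRe (i, j)).
exact: (mIm (i, j)).
Qed.

End MatrixConvergence.

(** * Entire matrix power series *)

Section EntireCriterion.
Local Open Scope classical_set_scope.
Variables (R : realType) (n : nat).
Local Notation C := (R[i] : numFieldType).

(** The factor [2 ^ s] is a crude substitute for the binomial coefficient
    [s (s - 1) / 2]; it is harmless for a series converging at every radius and
    keeps the induction short. *)
Lemma normc_expr_taylor1 (z h : R[i]) (r : R) s :
  1 <= r -> normc z + normc h <= r ->
  normc ((z + h) ^+ s - z ^+ s - s%:R * z ^+ s.-1 * h)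
    <= normc h ^+ 2 * (2 * r) ^+ s.
Proof.
move=> r1 zhr; have r0 : 0 <= r by rewrite (le_trans _ r1).
have zr : normc z <= r by rewrite (le_trans _ zhr) // lerDl normc_ge0.
elim: s => [|s IHs].
  by rewrite !expr0 subrr mul0r mul0r subr0 normc0 mulr1 sqr_ge0.
(* The remainder [e] at exponent [s] becomes [(z + h) e + s z^(s-1) h^2] at
   exponent [s.+1]. *)
have -> : (z + h) ^+ s.+1 - z ^+ s.+1 - s.+1%:R * z ^+ s.+1.-1 * h =
    (z + h) * ((z + h) ^+ s - z ^+ s - s%:R * z ^+ s.-1 * h)
    + s%:R * z ^+ s.-1 * h ^+ 2.
  case: s {IHs} => [|s] /=; first by rewrite !expr0 !expr1; ring.
  by rewrite !exprS -!natr1; ring.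
rewrite (le_trans (le_normcD _ _)) // !normcM !normcX normc_nat.
have le1 : normc (z + h) <= r by rewrite (le_trans (le_normcD _ _)).
have le2 : normc z ^+ s.-1 <= r ^+ s.+1.
  rewrite (@le_trans _ _ (r ^+ s.-1)) //.
    by rewrite lerXn2r ?nnegrE ?normc_ge0.
  by rewrite ler_weXn2l // (leq_trans (leq_pred _)).
have le3 : s%:R <= 2 ^+ s :> R by rewrite -natrX ler_nat ltnW // ltn_expl.
apply: (@le_trans _ _ (r * (normc h ^+ 2 * (2 * r) ^+ s)
    + 2 ^+ s * r ^+ s.+1 * normc h ^+ 2)).
  apply: lerD; first by apply: ler_pM; rewrite ?normc_ge0.
  rewrite ler_wpM2r ?sqr_ge0 //; apply: ler_pM => //.
  by rewrite exprn_ge0 ?normc_ge0.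
by rewrite !exprMn !exprS le_eqVlt; apply/orP; left; apply/eqP; ring.
Qed.

(** Absolute convergence at every radius gives differentiability without any
    interchange of limits: the bound [|h|^2 S] on the Taylor remainder holds for
    every partial sum with the same [S], hence for the sum. *)
Lemma entire_mxpseries_summable (U : nat -> 'M[C]_n) :
  (forall r : R, 0 <= r -> cvgn (series (fun s => mxnorm1 (U s) * r ^+ s))) ->
  @entire_mxpseries C n U.
Proof.
move=> sumU.
have cvgU (z : C) : cvgn (mxpseries U z).
  apply: cvg_series_mxnorm1 (sumU _ (normc_ge0 z)) => s.
  by rewrite mxnorm1Z normcX mulrC.
split; first exact: cvgU.
move=> z; pose r : R := normc z + 1.
have r1 : 1 <= r by rewrite lerDr normc_ge0.
have r0 : 0 <= r by rewrite (le_trans _ r1).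
have cU : cvgn (series (fun s => mxnorm1 (U s) * (2 * r) ^+ s)).
  by apply: sumU; rewrite mulr_ge0.
pose S : R := limn (series (fun s => mxnorm1 (U s) * (2 * r) ^+ s)).
have leS m : series (fun s => mxnorm1 (U s) * (2 * r) ^+ s) m <= S.
  apply: nondecreasing_cvgn_le => //; apply/nondecreasing_seqP => k.
  rewrite /series /= big_nat_recr //= lerDl.
  by rewrite mulr_ge0 ?mxnorm1_ge0 // exprn_ge0 // mulr_ge0.
have S0 : 0 <= S by apply: le_trans (leS 0); rewrite /series /= big_geq.
pose dU : nat -> 'M[C]_n := fun s => (s%:R * z ^+ s.-1) *: U s.
have cdU : cvgn (series dU).
  apply: cvg_series_mxnorm1 cU => s.
  rewrite mxnorm1Z normcM normc_nat normcX mulrC ler_wpM2l ?mxnorm1_ge0 //.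
  rewrite exprMn ler_pM ?exprn_ge0 ?normc_ge0 //.
    by rewrite -natrX ler_nat ltnW // ltn_expl.
  rewrite (@le_trans _ _ (r ^+ s.-1)) //.
    by rewrite lerXn2r ?nnegrE ?normc_ge0 // lerDl.
  by rewrite ler_weXn2l // leq_pred.
pose G := limn (series dU).
have remainder (h : C) : normc h <= 1 ->
    mxnorm1 (mxpseries_sum U (z + h) - mxpseries_sum U z - h *: G)
    <= normc h ^+ 2 * S.
  move=> h1.
  have cvgr : mxpseries U (z + h) m - mxpseries U z m - h *: series dU m
      @[m --> \oo] --> mxpseries_sum U (z + h) - mxpseries_sum U z - h *: G.
    apply: cvgB; last by apply: cvgZl_tmp.
    by apply: cvgB; exact: cvgU.
  apply: (mxnorm1_cvg_le _ cvgr) => m.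
  have -> : mxpseries U (z + h) m - mxpseries U z m - h *: series dU m =
      \sum_(0 <= s < m) ((z + h) ^+ s - z ^+ s - s%:R * z ^+ s.-1 * h) *: U s.
    rewrite /mxpseries /series /= scaler_sumr -!sumrB; apply: eq_bigr => s _.
    by rewrite /dU scalerA !scalerBl (mulrC h).
  rewrite (le_trans (mxnorm1_sum _ _ _)) //.
  rewrite (le_trans _ (ler_wpM2l _ (leS m))) ?sqr_ge0 //.
  rewrite mulr_sumr; apply: ler_sum => s _.
  rewrite mxnorm1Z [in leRHS]mulrCA mulrC ler_wpM2l ?mxnorm1_ge0 //.
  by apply: normc_expr_taylor1 => //; rewrite lerD2l.
apply/cvg_ex; exists G; apply/cvg_mxnorm1P => e e0.
pose d := Num.min 1 (e / (S + 1)).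
have d0 : 0 < d by rewrite lt_min ltr01 divr_gt0 // ltr_wpDl.
near=> h.
have h0 : h != 0 by near: h; exact: nbhs_dnbhs_neq.
have hd : normc h < d.
  by rewrite -ltcR; near: h; apply: dnbhs0_lt; rewrite ltcR.
have /andP[h1 he] : (normc h < 1) && (normc h < e / (S + 1)) by rewrite -lt_min.
have nh0 : 0 < normc h.
  rewrite lt_neqAle normc_ge0 andbT eq_sym.
  by apply: contra h0 => /eqP/eq0_normc->.
rewrite /= [h *: 1]mulr1.
have quotient_sub (D : 'M[C]_n) : G - h^-1 *: D = - h^-1 *: (D - h *: G).
  by rewrite scaleNr scalerBr scalerA mulVf // scale1r opprB.
rewrite [h + z]addrC quotient_sub.
rewrite mxnorm1Z normcN normcV -ltr_pdivlMl ?invr_gt0 // invrK.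
rewrite (le_lt_trans (remainder _ (ltW h1))) // expr2 -mulrA ltr_pM2l //.
rewrite (@le_lt_trans _ _ (normc h * (S + 1))) //.
  by rewrite ler_wpM2l ?normc_ge0 // lerDl.
by rewrite -ltr_pdivlMr // ltr_wpDl.
Unshelve. all: by end_near. Qed.

End EntireCriterion.

(** * Factorial decay and order *)

Section GrowthAndOrder.
Local Open Scope classical_set_scope.
Variable R : realType.

Lemma geometric_upper_bound (v : R ^nat) (k : R) s0 :
  1 <= k -> (forall s, 0 <= v s) ->
  (forall s, (s0 <= s)%N -> v s.+1 <= k * v s) ->
  exists2 M, 0 < M & forall s, v s <= M * k ^+ s.
Proof.
move=> k1 v0 vS; have k0 : 0 <= k by rewrite (le_trans _ k1).
pose M := 1 + \sum_(i < s0.+1) v i.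
have M0 : 0 < M by rewrite ltr_pwDl // sumr_ge0.
exists M => // s; elim: s => [|s IHs].
  by rewrite mulr1 /M big_ord_recl /= addrCA lerDl addr_ge0 // sumr_ge0.
have [s0s|ss0] := leqP s0 s.
  by rewrite (le_trans (vS _ s0s)) // exprS mulrCA ler_wpM2l.
rewrite (@le_trans _ _ M) //; last by rewrite ler_peMr ?(ltW M0) // exprn_ege1.
rewrite /M (bigD1 (Ordinal (ss0 : (s.+1 < s0.+1)%N))) //= addrCA lerDl.
by rewrite addr_ge0 // sumr_ge0.
Qed.

Lemma geometric_lower_bound (v : R ^nat) (k : R) s0 :
  1 <= k -> (forall s, 0 < v s) ->
  (forall s, (s0 <= s)%N -> v s <= k * v s.+1) ->
  exists2 m, 0 < m & forall s, m <= v s * k ^+ s.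
Proof.
move=> k1 v0 vS; have k0 : 0 < k by rewrite (lt_le_trans _ k1).
have [|s|s s0s|M M0 vM] :=
  @geometric_upper_bound (fun s => (v s)^-1) k s0 => //.
- by rewrite invr_ge0 ltW.
- by rewrite ler_pdivlMr // mulrC ler_pdivrMr // vS.
exists M^-1; first by rewrite invr_gt0.
by move=> s; rewrite -div1r ler_pdivrMr // -mulrA -ler_pdivrMl // mulr1 mulrC.
Qed.

(** The crude form of Stirling's formula: [s ln s] increases by
    [ln (s + 1) + s ln (1 + 1/s)] from [s] to [s + 1], and the second term lies
    between 0 and 1. *)
Lemma ln_fact_bounds s :
  s%:R * ln s%:R - s%:R <= ln (s`!%:R : R) <= s%:R * ln s%:R.
Proof.
elim: s => [|s /andP[lb ub]]; first by rewrite !mul0r fact0 ln1 subr0 lexx.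
have S0 : 0 < s.+1%:R :> R by [].
have f0 : 0 < s`!%:R :> R by rewrite ltr0n fact_gt0.
have step : s%:R * ln s%:R <= s%:R * ln (s.+1%:R : R) <= s%:R * ln s%:R + 1.
  case: s {lb ub S0 f0} => [|s]; first by rewrite !mul0r lexx add0r ler01.
  rewrite ler_wpM2l ?ler_ln ?posrE ?ler_nat //=.
  rewrite -lerBlDl -mulrBr -ln_div ?posrE //.
  rewrite -ler_pdivlMl // mulr1 (_ : _ / _ = 1 + s.+1%:R^-1); last first.
    by rewrite -[s.+2%:R]natr1 mulrDl divff // mul1r.
  by apply: le_ln1Dx; rewrite (lt_trans (ltrN10 _)) // invr_gt0.
rewrite factS natrM lnM ?posrE //.
have -> : s.+1%:R * ln s.+1%:R = ln s.+1%:R + s%:R * ln s.+1%:R :> R.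
  by rewrite -[in X in X * _]natr1 mulrDl mul1r addrC.
have := step; rewrite -natr1; lra.
Qed.

(** If [w s] is [(s!)^-2] up to geometric factors, then
    [|ln (1 / w s) - 2 s ln s| <= c s]; dividing by [s ln s], the error is
    [c / ln s], which tends to 0. *)
Lemma cvg_order_half (w : R ^nat) (m M k : R) :
  0 < m -> 1 <= k ->
  (forall s, m <= w s * s`!%:R ^+ 2 * k ^+ s) ->
  (forall s, w s * s`!%:R ^+ 2 <= M * k ^+ s) ->
  s%:R * ln s%:R / ln (1 / w s) @[s --> \oo] --> (1 / 2 : R).
Proof.
move=> m0 k1 mw wM; have k0 : 0 < k by rewrite (lt_le_trans _ k1).
have f0 s : 0 < s`!%:R :> R by rewrite ltr0n fact_gt0.
have w0 s : 0 < w s.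
  by have := lt_le_trans m0 (mw s); rewrite !pmulr_lgt0 ?exprn_gt0.
have M0 : 0 < M.
  have : 0 < M * k ^+ 0.
    by apply: lt_le_trans (wM 0); rewrite mulr_gt0 ?exprn_gt0.
  by rewrite expr0 mulr1.
have lnk0 : 0 <= ln k by exact: ln_ge0.
pose c : R := `|ln m| + `|ln M| + ln k + 2.
have c0 : 0 < c by rewrite ltr_wpDl // !addr_ge0.
have near_ln s : (0 < s)%N ->
    `|ln (1 / w s) - 2 * (s%:R * ln s%:R)| <= c * s%:R.
  move=> s0; have s1 : 1 <= s%:R :> R by rewrite ler1n.
  have /andP[] := ln_fact_bounds s.
  have : ln m <= ln (w s * s`!%:R ^+ 2 * k ^+ s).
    by rewrite ler_ln ?posrE ?mulr_gt0 ?exprn_gt0.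
  have : ln (w s * s`!%:R ^+ 2) <= ln (M * k ^+ s).
    by rewrite ler_ln ?posrE ?mulr_gt0 ?exprn_gt0.
  rewrite div1r lnV ?posrE // !lnM ?posrE ?mulr_gt0 ?exprn_gt0 // lnXn //.
  rewrite -[ln k *+ s]mulr_natr.
  have lem : - (`|ln m| * s%:R) <= ln m.
    rewrite lerNl (le_trans _ (ler_peMr _ s1)) //.
    by rewrite -normrN ler_norm.
  have leM : ln M <= `|ln M| * s%:R.
    by rewrite (le_trans (ler_norm _)) // ler_peMr.
  have := mulr_ge0 (normr_ge0 (ln m)) (ler0n R s).
  have := mulr_ge0 (normr_ge0 (ln M)) (ler0n R s).
  have := mulr_ge0 lnk0 (ler0n R s).
  rewrite /c ler_norml !mulrDl; lra.
apply/cvgrPdist_le => e e0; near=> s.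
have s0 : (0 < s)%N by near: s; exact: nbhs_infty_gt.
have S0 : 0 < s%:R :> R by rewrite ltr0n.
(* [ln s >= c] gives [ln (1 / w s) >= s ln s], which keeps the denominator under
   control; [ln s >= c / e] then makes the error at most [e]. *)
have ln_large : c + c / e <= ln s%:R.
  rewrite -[leLHS]expRK ler_ln ?posrE ?expR_gt0 //.
  near: s; exact: nbhs_infty_ger.
have ce0 : 0 < c / e by rewrite divr_gt0.
have := near_ln s s0; set L := ln (1 / w s); set l := ln s%:R in ln_large *.
move=> near_L.
have L_ge : s%:R * l <= L.
  have : s%:R * c <= s%:R * l by rewrite ler_wpM2l //; lra.
  by move: near_L; rewrite ler_norml; lra.
have l0 : 0 < l by lra.
have L0 : 0 < L by rewrite (lt_le_trans _ L_ge) // mulr_gt0.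
have -> : 1 / 2 - s%:R * l / L = (L - 2 * (s%:R * l)) / (2 * L).
  by field; rewrite gt_eqF.
rewrite normrM normfV [`|2 * L|]gtr0_norm ?mulr_gt0 //.
rewrite ler_pdivrMr ?mulr_gt0 // (le_trans near_L) //.
have cl : c <= e * l.
  by rewrite mulrC -ler_pdivrMr //; lra.
apply: (@le_trans _ _ (e * (s%:R * l))).
  by rewrite mulrCA [leLHS]mulrC ler_wpM2l.
rewrite ler_wpM2l ?(ltW e0) //; lra.
Unshelve. all: by end_near. Qed.

End GrowthAndOrder.

(** * The recurrence for the hypergeometric coefficients *)

Section PochhammerRecurrence.
Variables (R : realType) (n : nat).
Implicit Types A B C X : 'M[R[i]]_n.

Lemma mxpochS A s : mxpoch A s.+1 = mxpoch A s *m (A + s%:R%:M).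
Proof. by rewrite /mxpoch big_ord_recr. Qed.

Lemma comm_mx_shift A B s : comm_mx A B -> comm_mx A (B + s%:R%:M).
Proof. by move=> AB; apply: comm_mxD => //; exact: comm_mx_scalar. Qed.

Lemma comm_mx_poch A B s : comm_mx A B -> comm_mx A (mxpoch B s).
Proof.
move=> AB; elim: s => [|s IHs].
  by rewrite /mxpoch big_ord0; exact: comm_mx1.
by rewrite mxpochS; apply: comm_mxM => //; exact: comm_mx_shift.
Qed.

Lemma comm_mx_inv A B : B \in unitmx -> comm_mx A B -> comm_mx A (invmx B).
Proof.
move=> uB AB; rewrite /comm_mx -[LHS](mulKmx uB) [B *m (A *m _)]mulmxA -AB.
by rewrite -mulmxA mulmxV // mulmx1.
Qed.

Lemma mxpoch_unit B s :
  (forall s : nat, B + s%:R%:M \in unitmx) -> mxpoch B s \in unitmx.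
Proof.
move=> uB; elim: s => [|s IHs]; first by rewrite /mxpoch big_ord0 unitmx1.
by rewrite mxpochS unitmx_mul IHs uB.
Qed.

Lemma mulmx_inv_mxpochS B s :
  (forall s : nat, B + s%:R%:M \in unitmx) ->
  (B + s%:R%:M) *m invmx (mxpoch B s.+1) = invmx (mxpoch B s).
Proof.
move=> uB; have := mulmxV (mxpoch_unit s.+1 uB).
rewrite {1}mxpochS -mulmxA => /(congr1 (mulmx (invmx (mxpoch B s)))).
by rewrite mulKmx ?mxpoch_unit // mulmx1.
Qed.

(** Writing the recurrence with all factors [B + s] and [C + s] on the same side
    as [U_(s+1)] avoids inverses, so that [mxnorm1_shift_le] and
    [mxnorm1_shift_ge] apply to every factor.  Commutativity serves to bring
    [C + s] and [B + s] next to the inverse Pochhammer matrices they cancel. *)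
Lemma hyp1F2_coefS A B C s :
  comm_mx A B -> comm_mx A C -> comm_mx B C ->
  (forall s : nat, B + s%:R%:M \in unitmx) ->
  (forall s : nat, C + s%:R%:M \in unitmx) ->
  s.+1%:R *: ((B + s%:R%:M) *m ((C + s%:R%:M) *m hyp1F2_coef A B C s.+1))
  = (A + s%:R%:M) *m hyp1F2_coef A B C s.
Proof.
move=> AB AC BC uB uC; rewrite /hyp1F2_coef -!scalemxAr scalerA.
rewrite factS natrM invfM mulVKf ?pnatr_eq0 //; congr (_ *: _).
set b := B + _; set c := C + _; set a := A + _.
have cP : comm_mx c (mxpoch A s.+1).
  by apply: comm_mx_poch; apply: comm_mx_sym; apply: comm_mx_shift.
have bP : comm_mx b (mxpoch A s.+1).
  by apply: comm_mx_poch; apply: comm_mx_sym; apply: comm_mx_shift.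
have cB : comm_mx c (invmx (mxpoch B s.+1)).
  apply: comm_mx_inv; first exact: mxpoch_unit.
  by apply: comm_mx_poch; apply: comm_mx_sym; apply: comm_mx_shift.
have aP : comm_mx a (mxpoch A s).
  by apply: comm_mx_poch; apply: comm_mx_sym; apply: comm_mx_shift.
rewrite !mulmxA -(mulmxA b) cP !mulmxA bP -!mulmxA (mulmxA c) cB.
rewrite -(mulmxA _ c) mulmx_inv_mxpochS // (mulmxA b) mulmx_inv_mxpochS //.
by rewrite mxpochS -!mulmxA !(mulmxA _ a) !mulmxA -aP.
Qed.

End PochhammerRecurrence.

(** * Growth of the hypergeometric coefficients *)

(** The norms of [U_s], [U_(s+1)], [(C + s) U_(s+1)], [(B + s) (C + s) U_(s+1)]
    and [(A + s) U_s] are [u], [u'], [x], [y] and [z], and [r] is [s].  Once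
    [r >= 2 (a + b + c) + 1], each factor [r - d] with [d <= a + b + c] is at
    least [(r + 1) / 2] and each [r + d] at most [2 (r + 1)].  There are two
    such factors next to [u'] and one next to [u], whence [2 ^ 3 = 8] in both
    directions. *)
Lemma recurrence_ratio_bounds (R : realFieldType) (a b c r u u' x y z : R) :
  0 <= a -> 0 <= b -> 0 <= c -> 2 * (a + b + c) + 1 <= r ->
  0 <= u -> 0 <= u' -> 0 <= x ->
  (r - c) * u' <= x -> x <= (r + c) * u' ->
  (r - b) * x <= y -> y <= (r + b) * x ->
  (r - a) * u <= z -> z <= (r + a) * u ->
  (r + 1) * y = z ->
  (r + 1) ^+ 2 * u' <= 8 * u /\ u <= 8 * ((r + 1) ^+ 2 * u').
Proof.
move=> a0 b0 c0 tr u0 u'0 x0 Cge Cle Bge Ble Age Ale yz.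
pose q := r + 1.
have q0 : 0 < q by rewrite /q; lra.
have halve d : d <= a + b + c -> q / 2 <= r - d by rewrite /q; lra.
have double d : d <= a + b + c -> r + d <= 2 * q by rewrite /q; lra.
have xge : q / 2 * u' <= x.
  by rewrite (le_trans _ Cge) // ler_wpM2r // halve; lra.
have xle : x <= 2 * q * u'.
  by rewrite (le_trans Cle) // ler_wpM2r // double; lra.
have yge : q / 2 * x <= y.
  by rewrite (le_trans _ Bge) // ler_wpM2r // halve; lra.
have yle : y <= 2 * q * x.
  by rewrite (le_trans Ble) // ler_wpM2r // double; lra.
have zge : q / 2 * u <= z.
  by rewrite (le_trans _ Age) // ler_wpM2r // halve; lra.
have zle : z <= 2 * q * u.
  by rewrite (le_trans Ale) // ler_wpM2r // double; lra.
rewrite -/q in yz *.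
have yge' : q / 2 * (q / 2 * u') <= y.
  by rewrite (le_trans _ yge) // ler_wpM2l // divr_ge0 // ltW.
have yle' : y <= 2 * q * (2 * q * u').
  by rewrite (le_trans yle) // ler_wpM2l // mulr_ge0 // ltW.
have up : q * (q / 2 * (q / 2 * u')) <= q * (2 * u).
  by rewrite (le_trans _ (_ : z <= _)) //; [rewrite -yz ler_pM2l|lra].
have lo : q * (u / 2) <= q * (2 * q * (2 * q * u')).
  by rewrite (@le_trans _ _ z) //; [lra|rewrite -yz ler_pM2l].
rewrite !ler_pM2l // in up lo.
by split; lra.
Qed.

Section HypergeometricGrowth.
Variables (R : realType) (n : nat) (A B C : 'M[R[i]]_n).
Hypotheses (comAB : comm_mx A B) (comAC : comm_mx A C) (comBC : comm_mx B C).
Hypothesis unitB : forall s : nat, B + s%:R%:M \in unitmx.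
Hypothesis unitC : forall s : nat, C + s%:R%:M \in unitmx.

Local Notation U := (hyp1F2_coef A B C).

Lemma mxnorm1_hyp1F2_coef_ratio : exists s0 : nat, forall s, (s0 <= s)%N ->
  s.+1%:R ^+ 2 * mxnorm1 (U s.+1) <= 8 * mxnorm1 (U s) /\
  mxnorm1 (U s) <= 8 * (s.+1%:R ^+ 2 * mxnorm1 (U s.+1)).
Proof.
pose t := 2 * (mxnorm1 A + mxnorm1 B + mxnorm1 C) + 1.
have t0 : 0 <= t by rewrite addr_ge0 // mulr_ge0 // !addr_ge0 // mxnorm1_ge0.
exists (Num.bound t) => s ts; rewrite -natr1.
have {}ts : t <= s%:R.
  by rewrite (le_trans (ltW (archi_boundP t0))) // ler_nat.
pose X := (C + s%:R%:M) *m U s.+1.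
apply: (@recurrence_ratio_bounds R (mxnorm1 A) (mxnorm1 B) (mxnorm1 C) s%:R
  (mxnorm1 (U s)) (mxnorm1 (U s.+1)) (mxnorm1 X)
  (mxnorm1 ((B + s%:R%:M) *m X)) (mxnorm1 ((A + s%:R%:M) *m U s)));
  rewrite ?mxnorm1_ge0 ?mxnorm1_shift_ge ?mxnorm1_shift_le //.
by rewrite natr1 -hyp1F2_coefS // mxnorm1Z normc_nat.
Qed.

Local Notation v := (fun s => mxnorm1 (U s) * s`!%:R ^+ 2).

Lemma mxnorm1_hyp1F2_coef_upper :
  exists2 M, 0 < M & forall s,
    mxnorm1 (U s) * s`!%:R ^+ 2 <= M * 8 ^+ s.
Proof.
have [s0 ratio] := mxnorm1_hyp1F2_coef_ratio.
apply: (@geometric_upper_bound _ v 8 s0) => [|s|s s0s]; first by rewrite ler1n.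
  by rewrite mulr_ge0 ?mxnorm1_ge0 // sqr_ge0.
rewrite factS natrM exprMn !(mulrA _ _ (s`!%:R ^+ 2)) ler_wpM2r ?sqr_ge0 //.
by rewrite mulrC; have [] := ratio s s0s.
Qed.

Lemma mxnorm1_hyp1F2_coef_lower : (forall s, mxpoch A s <> 0) ->
  exists2 m, 0 < m & forall s,
    m <= mxnorm1 (U s) * s`!%:R ^+ 2 * 8 ^+ s.
Proof.
move=> A0; have [s0 ratio] := mxnorm1_hyp1F2_coef_ratio.
apply: (@geometric_lower_bound _ v 8 s0) => [|s|s s0s]; first by rewrite ler1n.
  rewrite mulr_gt0 ?exprn_gt0 ?ltr0n ?fact_gt0 // mxnorm1_gt0 //.
  apply/eqP => /(congr1 (fun X => s`!%:R *: (X *m mxpoch C s *m mxpoch B s))).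
  rewrite /hyp1F2_coef -!scalemxAl scalerA.
  rewrite divff ?scale1r ?pnatr_eq0 -?lt0n ?fact_gt0 //.
  by rewrite !mulmxKV ?mxpoch_unit // !mul0mx scaler0; exact: A0.
rewrite factS natrM exprMn !(mulrA _ _ (s`!%:R ^+ 2)) ler_wpM2r ?sqr_ge0 //.
by rewrite [_ * _ ^+ 2]mulrC; have [] := ratio s s0s.
Qed.

(** Dropping one factor [s!] from the upper bound leaves the exponential series
    at [8 r]. *)
Lemma hyp1F2_coef_summable (r : R) : 0 <= r ->
  cvgn (series (fun s => mxnorm1 (U s) * r ^+ s)).
Proof.
move=> r0; have [M M0 vM] := mxnorm1_hyp1F2_coef_upper.
apply: (@series_le_cvg _ _ (M *: exp_coeff (8 * r))) => [s|s|s|].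
- by rewrite mulr_ge0 ?mxnorm1_ge0 // exprn_ge0.
- rewrite /= mulr_ge0 ?(ltW M0) // /exp_coeff /=.
  by rewrite divr_ge0 // exprn_ge0 // mulr_ge0.
- have f1 : 1 <= s`!%:R :> R by rewrite ler1n fact_gt0.
  have f0 : 0 < s`!%:R :> R by rewrite ltr0n fact_gt0.
  rewrite [leRHS](_ : _ = M * ((8 * r) ^+ s / s`!%:R)) // exprMn.
  rewrite mulrA ler_pdivlMr // mulrAC mulrA ler_wpM2r ?exprn_ge0 //.
  rewrite (le_trans _ (vM s)) // ler_wpM2l ?mxnorm1_ge0 //.
  by rewrite expr2 ler_peMr // ltW.
- by apply: is_cvg_seriesZ; exact: is_cvg_series_exp_coeff.
Qed.

End HypergeometricGrowth.

(* The non-termination premise bears only on the value of the order: if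
   (A)_s = 0 for some s, the series is a polynomial, of order 0. *)
Theorem theorem2p2 (R : realType) (N : nat) (A B C : 'M[R[i]]_N)
    (comAB : comm_mx A B) (comAC : comm_mx A C) (comBC : comm_mx B C)
    (unitB : forall s : nat, B + s%:R%:M \in unitmx)
    (unitC : forall s : nat, C + s%:R%:M \in unitmx) :
  entire_mxpseries (hyp1F2_coef A B C) /\
  ((forall s : nat, mxpoch A s <> 0) ->
   mxpseries_order (hyp1F2_coef A B C) = (1 / 2)%:E).
Proof.
split=> [|A0].
  by apply: entire_mxpseries_summable => r; exact: hyp1F2_coef_summable.
have [M M0 upper] := mxnorm1_hyp1F2_coef_upper comAB comAC comBC unitB unitC.
have [m m0 lower] := mxnorm1_hyp1F2_coef_lower comAB comAC comBC unitB unitC A0.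
(* For [N = 0] every matrix is zero, against the positive lower bound. *)
have NN0 : 0 < (N * N)%:R :> R.
  rewrite lt_neqAle ler0n andbT; apply: contraTneq m0 => NN0.
  rewrite -leNgt (le_trans (lower 0)) //.
  have := mxnorm1_le_opnorm2 (hyp1F2_coef A B C 0).
  by rewrite -NN0 mul0r fact0 !expr0 !mulr1 expr1n mulr1.
have order_cvg := @cvg_order_half R (fun s => opnorm2 (hyp1F2_coef A B C s))
  (m / (N * N)%:R) M 8.
apply: (cvg_limn_einf_sup _).2; apply: cvg_EFin.
  exact: nearW.
apply: order_cvg => [||s|s].
- by rewrite divr_gt0.
- by rewrite ler1n.
- rewrite ler_pdivrMr // (le_trans (lower s)) // [leRHS]mulrC !mulrA.
  rewrite !ler_wpM2r ?exprn_ge0 //; exact: mxnorm1_le_opnorm2.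
- rewrite (le_trans _ (upper s)) // ler_wpM2r ?exprn_ge0 //.
  exact: opnorm2_le_mxnorm1.
Qed.
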